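(* Let $\phi_k^{\mathrm{LGL}}$, $k=0,1,2,\ldots$, be the Legendre-Gauss-Lobatto polynomials: $\phi_0^{\mathrm{LGL}}(x)=P_1(x)$ and $\phi_k^{\mathrm{LGL}}(x)=P_{k+1}(x)-P_{k-1}(x)$ for $k\ge 1$. Then the following properties hold. (i) $|\phi_k^{\mathrm{LGL}}(x)|$ is an even function for $k=0,1,\ldots$, and $\phi_k^{\mathrm{LGL}}(\pm1)=0$ for $k=1,2,\ldots$. (ii) For $k=1,2,\ldots$, $$\phi_k^{\mathrm{LGL}}(x)=\frac{\mathrm{d}}{\mathrm{d}x}\left(\frac{\phi_{k+1}^{\mathrm{LGL}}(x)}{2k+3}-\frac{\phi_{k-1}^{\mathrm{LGL}}(x)}{2k-1}\right).$$ (iii) For an integer $n\ge1$, let $\nu=\lfloor (n+1)/2\rfloor$ and let $x_\nu<\cdots<x_1$ be the zeros of $P_n(x)$ on the interval $[0,1]$. Then $|\phi_n^{\mathrm{LGL}}(x)|$ attains its local maximum values (on $[0,1]$) at these points and $$|\phi_n^{\mathrm{LGL}}(x_1)|<|\phi_n^{\mathrm{LGL}}(x_2)|<\cdots<|\phi_n^{\mathrm{LGL}}(x_\nu)|.$$ (iv) The maximum value of $|\phi_n^{\mathrm{LGL}}(x)|$ satisfies $$\max_{x\in[-1,1]}|\phi_n^{\mathrm{LGL}}(x)|\le\frac{4}{\sqrt{2\pi n}},\qquad n=1,2,\ldots,$$ and the bound is optimal in the sense that it cannot be improved further, i.e. the constant $4/\sqrt{2\pi}$ cannot be replaced by any smaller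 constant (valid for all $n\ge1$).
   Context: $P_k(x)$ denotes the Legendre polynomial of degree $k$, normalized by $P_k(1)=1$ (so $\int_{-1}^1P_j(x)P_k(x)\,\mathrm{d}x=(k+\frac12)^{-1}\delta_{j,k}$). *)

(* Defs.v *)
From HB Require Import structures.
From mathcomp Require Import all_boot all_order all_algebra.
From mathcomp Require Import ring.
From mathcomp Require Import all_classical all_reals all_analysis.

Set Implicit Arguments.
Unset Strict Implicit.
Unset Printing Implicit Defensive.

Import Order.TTheory GRing.Theory Num.Theory.
Import numFieldNormedType.Exports.

Local Open Scope classical_set_scope.
Local Open Scope ring_scope.

(* Rodrigues' formula; it has the normalization P_k(1) = 1, see legendre1. *)
Definition legendre (R : realType) (k : nat) : {poly R} :=
  (2 ^+ k * (k`!)%:R)^-1 *: (('X^2 - 1) ^+ k)^`(k).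

Lemma size_legendre (R : realType) (k : nat) : size (legendre R k) = k.+1.
Proof.
have mon : ('X^2 - 1 : {poly R}) ^+ k \is monic.
  by rewrite monic_exp // monic_Xn_sub_1.
have sz : size (('X^2 - 1 : {poly R}) ^+ k) = (k + k).+1.
  have := size_exp ('X^2 - 1 : {poly R}) k.
  rewrite size_Xn_sub_1 // => e; rewrite -[LHS]prednK ?e ?mul2n ?addnn //.
  by rewrite lt0n size_poly_eq0 monic_neq0.
rewrite /legendre nderivn_def size_scale; last first.
  by rewrite invr_neq0 // mulf_neq0 // ?expf_neq0 // pnatr_eq0 -?lt0n ?fact_gt0.
rewrite -scaler_nat size_scale ?pnatr_eq0 -?lt0n ?fact_gt0 // /nderivn sz.
have -> : ((k + k).+1 - k = k.+1)%N by rewrite subSn ?leq_addr // addKn.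
rewrite size_poly_eq //=.
have := monicP mon; rewrite lead_coefE sz /= => ->.
by rewrite pnatr_eq0 -lt0n bin_gt0 leq_addr.
Qed.

Lemma legendre1 (R : realType) (k : nat) : (legendre R k).[1] = 1.
Proof.
have key (q : {poly R}) :
    ((('X - 1) ^+ k * q)^`(k)).[1] = (k`!)%:R * q.[1].
  elim: k q => [|k IH] q; first by rewrite derivn0 expr0 !mul1r.
  have -> : (('X - 1) ^+ k.+1 * q)^`(k.+1) =
            (('X - 1) ^+ k * (q *+ k.+1 + ('X - 1) * q^`()))^`(k).
    rewrite derivSn derivM deriv_exp derivB derivX -polyC1 derivC subr0 mul1r.
    by rewrite mulrDr mulrA -exprSr mulrnAl -mulrnAr.
  by rewrite IH !hornerE subrr mul0r addr0 hornerMn factS mulrC natrM -mulr_natr; ring.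
rewrite /legendre hornerZ.
have -> : 'X^2 - 1 = ('X - 1) * ('X + 1) :> {poly R} by rewrite -subr_sqr expr1n.
rewrite exprMn key horner_exp hornerD hornerX -polyC1 hornerC [k`!%:R * _]mulrC mulVf //.
Qed.

Definition phiLGL (R : realType) (k : nat) : {poly R} :=
  if k is j.+1 then legendre R j.+2 - legendre R j else legendre R 1.

Definition is_local_max_on (R : realType) (A : set R) (f : R -> R) (x : R) :=
  A x /\ \forall y \near within A (nbhs x), f y <= f x.

Definition is_max_on (R : realType) (A : set R) (f : R -> R) (M : R) :=
  (f @` A) M /\ ubound (f @` A) M.

(* Main.v *)
Require Import Defs.
From HB Require Import structures.
From mathcomp Require Import all_boot all_order all_algebra.
From mathcomp Require Import ring lra zify.
From mathcomp Require Import polyrcf.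
From mathcomp Require Import all_classical all_reals all_analysis.

Set Implicit Arguments.
Unset Strict Implicit.
Unset Printing Implicit Defensive.

Import Order.TTheory GRing.Theory Num.Theory.
Import numFieldNormedType.Exports.

Local Open Scope classical_set_scope.
Local Open Scope ring_scope.

(* The engine is the differential equation (1 - x^2) phi'' = - n(n+1) phi for
   phi = phi_n, whose derivative is phi' = (2n+1) P_n.  Sonin's function
   F = phi^2 + (1 - x^2) phi'^2 / (n(n+1)) satisfies F' = - 2 x phi'^2 / (n(n+1)),
   so it decreases strictly on [0,1]; it dominates phi^2 and agrees with it at the
   zeros of P_n, which gives the ordering of the local maxima.  It also gives
   max phi^2 <= F(0), an expression in the central values P_{2m}(0), whose squares
   are (up to a factor (pi/2)^2) those of the Wallis integrals of even index.  The sharp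
   bound is P_{2m}(0)^2 <= 4 / (pi (4m+1)), because (4m+1) P_{2m}(0)^2 increases to
   4/pi; for odd n the maximum is attained at 0, and P_{2m}(0)^2 >= 2 / (pi (2m+1))
   shows that the constant is optimal. *)

(** * Differential identities from Rodrigues' formula *)

Lemma derivn_mulX (R : comNzRingType) (p : {poly R}) (n : nat) :
  ('X * p)^`(n.+1) = 'X * p^`(n.+1) + p^`(n) *+ n.+1.
Proof.
elim: n => [|n IH]; first by rewrite derivn1 derivM derivX mul1r mulr1n addrC.
rewrite derivnS IH derivD derivM derivX mul1r derivMn -!derivnS.
by rewrite addrC addrA [RHS]addrC -mulrSr.
Qed.

Section LegendreIdentities.
Variable R : realType.
Local Notation P := (legendre R).
Local Notation u := ('X^2 - 1 : {poly R}).
Local Notation c n := (2 ^+ n * (n`!)%:R : R).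

Let c_neq0 n : c n != 0.
Proof. by rewrite mulf_neq0 ?expf_neq0 // pnatr_eq0 -lt0n fact_gt0. Qed.

Let cS n : c n.+1 = 2 * n.+1%:R * c n.
Proof. by rewrite exprS factS natrM; ring. Qed.

Lemma rodrigues n : (u ^+ n)^`(n) = c n *: P n.
Proof. by rewrite /legendre scalerA divff // scale1r. Qed.

Let rodrigues_deriv n : (u ^+ n)^`(n.+1) = c n *: (P n)^`().
Proof. by rewrite derivnS rodrigues derivZ. Qed.

Let deriv_u_exp n : (u ^+ n.+1)^`() = (2 * n.+1%:R) *: ('X * u ^+ n).
Proof.
rewrite deriv_exp /= derivB -polyC1 derivC subr0 derivXn /= expr1.
rewrite -mul_polyC polyCM !polyC_natr -mulr_natl; ring.
Qed.

Lemma legendre0 : P 0 = 1.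
Proof. by rewrite /legendre expr0 derivn0 fact0 mulr1 expr0 invr1 scale1r. Qed.

(** One derivative of [u ^+ n.+1] gives a multiple of ['X * u ^+ n]; Leibniz's rule handles the
    remaining [n.+1] derivatives. *)
Lemma deriv_legendreS n :
  (P n.+1)^`() = 'X * (P n)^`() + n.+1%:R *: P n.
Proof.
apply: (scalerI (c_neq0 n.+1)).
rewrite -rodrigues_deriv derivSn deriv_u_exp derivnZ derivn_mulX.
rewrite rodrigues rodrigues_deriv cS -!mul_polyC !polyCM !polyC_natr.
by ring.
Qed.

(** Since ['X^2 = u + 1], two derivatives of [u ^+ n.+2] give a combination of [u ^+ n.+1] and
    [u ^+ n]; the remaining [n.+1] derivatives turn these into multiples of [P n.+1] and of the
    derivative of [P n]. *)
Lemma deriv_legendre_sub n :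
  (P n.+2)^`() - (P n)^`() = (2 * n%:R + 3) *: P n.+1.
Proof.
apply: (scalerI (c_neq0 n.+2)).
have e : (u ^+ n.+2)^`()^`() =
   (2 * n.+2%:R * (2 * n%:R + 3)) *: u ^+ n.+1 + (4 * n.+2%:R * n.+1%:R) *: u ^+ n.
  rewrite deriv_u_exp derivZ derivM derivX deriv_u_exp -!mul_polyC.
  by rewrite !(polyCM, polyCD) !polyC_natr [u ^+ n.+1]exprS; ring.
rewrite scalerBr -rodrigues_deriv derivSn derivSn e derivnD !derivnZ rodrigues.
rewrite rodrigues_deriv !cS -!mul_polyC !(polyCM, polyCD) !polyC_natr.
by ring.
Qed.

Lemma legendre_ode n :
  ((1 - 'X^2) * (P n)^`())^`() = - (n * n.+1)%:R *: P n.
Proof.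
case: n => [|n].
  by rewrite legendre0 -polyC1 derivC mulr0 deriv0 mul0n oppr0 scale0r.
apply: (scalerI (c_neq0 n.+1)).
(* This is u w' = 2(n+1) X w for w = u^(n+1), with X^2 split into two factors so that [derivn_mulX]
   computes its derivative of order n+2, which is Legendre's equation. *)
have e : 'X * ('X * (u ^+ n.+1)^`()) - (u ^+ n.+1)^`() =
         (2 * n.+1%:R) *: ('X * u ^+ n.+1).
  by rewrite deriv_u_exp -!mul_polyC [u ^+ n.+1]exprS !polyCM !polyC_natr; ring.
have /(congr1 (derivn n.+2)) := e.
rewrite derivnB !derivnZ !derivn_mulX -!derivSn !rodrigues !rodrigues_deriv.
rewrite [(u ^+ _)^`(n.+3)]derivnS rodrigues_deriv derivZ.
rewrite derivM derivB -polyC1 derivC derivXn sub0r expr1.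
rewrite -!mul_polyC polyC1 !(polyCM, polyCN) !polyC_natr natrM.
set h := (LHS in LHS = _ -> _) => eh.
by apply: (addIr h); rewrite {2}eh /h; ring.
Qed.

Lemma legendre_parity n (x : R) : (P n).[- x] = (-1) ^+ n * (P n).[x].
Proof.
have comp_derivn (p : {poly R}) k : (p \Po - 'X)^`(k) = (-1) ^+ k *: (p^`(k) \Po - 'X).
  elim: k => [|k IH]; first by rewrite !derivn0 expr0 scale1r.
  rewrite derivnS IH derivZ deriv_comp -derivnS derivN derivX mulrN1 exprS.
  by rewrite mulN1r scalerN scaleNr.
have even_u : (u ^+ n) \Po - 'X = u ^+ n.
  by rewrite rmorphXn /= comp_polyB comp_Xn_poly sqrrN -polyC1 comp_polyC.
rewrite /legendre !hornerZ -{2}even_u comp_derivn hornerZ horner_comp hornerN hornerX.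
by rewrite [RHS]mulrCA [(-1) ^+ n * (_ * _)]mulrA -exprMn mulrNN mulr1 expr1n mul1r.
Qed.

Lemma phiLGL_deriv n : (phiLGL R n)^`() = (2 * n%:R + 1) *: P n.
Proof.
case: n => [|n]; rewrite /phiLGL.
  by rewrite deriv_legendreS legendre0 -polyC1 derivC mulr0 mulr0 !add0r.
rewrite derivB deriv_legendre_sub; congr (_ *: _).
by rewrite -[n.+1%:R]natr1; ring.
Qed.

(** Both sides have the same derivative, by [phiLGL_deriv] and [legendre_ode], and both vanish at
    1. *)
Lemma phiLGL_eq n :
  (n * n.+1)%:R *: phiLGL R n = - (2 * n%:R + 1) *: ((1 - 'X^2) * (P n)^`()).
Proof.
have deriv0_eq (p : {poly R}) a : p^`() = 0 -> p.[a] = 0 -> p = 0.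
  move=> dp pa; have : (size p <= 1)%N.
    rewrite leqNgt; apply/negP => sp.
    have p0 : p != 0 by rewrite -size_poly_eq0 -lt0n ltnW.
    have := congr1 (fun q : {poly R} => q`_(size p).-2) dp.
    rewrite coef_deriv coef0 -(subnKC sp) /= => /eqP.
    rewrite -mulr_natr mulf_eq0 pnatr_eq0 orbF.
    have -> : (size p - 2).+1 = (size p).-1 by lia.
    by rewrite -lead_coefE lead_coef_eq0 (negPf p0).
  by move=> /size1_polyC e; move: pa; rewrite e hornerC => ->.
apply/eqP; rewrite -subr_eq0; apply/eqP; apply: (@deriv0_eq _ 1).
  rewrite derivB 2!derivZ legendre_ode phiLGL_deriv.
  rewrite (scalerA _ (2 * _ + _)) (scalerA (- _) (- _)).
  by rewrite -scalerBl mulrNN mulrC subrr scale0r.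
rewrite hornerD hornerN 2!hornerZ hornerM.
have -> : (1 - 'X^2 : {poly R}).[1] = 0 by rewrite !hornerE ?expr1n subrr.
rewrite mul0r mulr0 subr0.
(* For n = 0 the value of phi at 1 is 1, and it is the factor n(n+1) that vanishes. *)
by case: n => [|n]; rewrite ?mul0n ?mul0r //= hornerD hornerN !legendre1 subrr mulr0.
Qed.

(** The three-term recurrence at 0, read off from [phiLGL_eq] because the derivative of [P n.+1] at
    0 is [n.+1] times the value of [P n] there. *)
Lemma legendre_center n :
  n.+2%:R * (P n.+2).[0] = - n.+1%:R * (P n).[0].
Proof.
have n0 : n.+1%:R != 0 :> R by rewrite pnatr_eq0.
have d0 : ((P n.+1)^`()).[0] = n.+1%:R * (P n).[0].
  by rewrite deriv_legendreS hornerD hornerM hornerX mul0r add0r hornerZ.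
have := congr1 (fun p => p.[0]) (phiLGL_eq n.+1).
rewrite hornerZ hornerZ hornerM d0 /= hornerD hornerN natrM.
have -> : (1 - 'X^2 : {poly R}).[0] = 1 by rewrite !hornerE ?expr0n subr0.
rewrite mul1r [RHS]mulrCA -mulrA => /(mulfI n0); rewrite mulrBr.
by move/(canRL (subrK _)) => ->; ring.
Qed.

End LegendreIdentities.

(** * Zeros of the Legendre polynomials *)

(** Rolle's theorem between consecutive roots. The strict bounds on [t] allow the two end points to
    be adjoined again before the next differentiation. *)
Lemma sorted_roots_deriv (R : rcfType) (p : {poly R}) (x : R) (s : seq R) :
  path <%R x s -> all (root p) (x :: s) ->
  exists t, [/\ size t = size s, sorted <%R t, all (root p^`()) t
              & all (fun z => x < z < last x s) t].
Proof.
elim: s x => [|y s IH] x /=; first by exists [::].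
move=> /andP[xy ys] /and3P[px py ps].
have [|t [st tt rt bt]] := IH y ys; first by rewrite /= py ps.
have [|c cxy dc] := @poly_rolle R x y p xy; first by rewrite (rootP px) (rootP py).
have ylast : y <= last y s.
  have : all (>= y) (y :: s).
    rewrite /= lexx; apply: order_path_min le_trans _.
    by apply: sub_path ys => a b /ltW.
  by move/allP; apply; rewrite mem_last.
have cy : c < y by rewrite (itvP cxy).
exists (c :: t); split; rewrite /= ?st ?rt ?andbT //.
- rewrite path_min_sorted //; apply/allP => z /(allP bt) /andP[yz _].
  exact: lt_trans yz.
- by rewrite rootE dc eqxx.
- rewrite (itvP cxy) (lt_le_trans cy ylast) /=.
  by apply/allP => z /(allP bt) /andP[yz ->]; rewrite (lt_trans xy yz).
Qed.

(** Each derivative lowers the multiplicity of a root by at most one. This keeps 1 and -1 among the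
    roots throughout the iteration of Rolle's theorem. *)
Lemma root_derivn_exp (R : idomainType) (a : R) (q : {poly R}) (n j : nat) :
  (j < n)%N -> root ((('X - a%:P) ^+ n * q)^`(j)) a.
Proof.
elim: j n q => [|j IH] [//|n] q jn.
  by rewrite derivn0 exprS -mulrA rootM root_XsubC eqxx.
rewrite derivSn derivM deriv_exp derivXsubC mul1r /= mulrnAl -mulrnAr.
by rewrite exprSr -mulrA -mulrDr IH.
Qed.

Section LegendreRoots.
Variable R : realType.
Local Notation P := (legendre R).

Lemma legendre_roots n : exists s : seq R,
  [/\ size s = n, sorted <%R s, all (fun z => -1 < z < 1) s & root (P n) =1 mem s].
Proof.
pose u : {poly R} := 'X^2 - 1.
have iter_rolle j : (j <= n)%N -> exists s : seq R, [/\ size s = j, sorted <%R s,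
    all (root (u ^+ n)^`(j)) s & all (fun z => -1 < z < 1) s].
  elim: j => [|j IH] jn; first by exists [::].
  have [s [ss sos rs bs]] := IH (ltnW jn).
  have uE : u = ('X - 1%:P) * ('X - (-1)%:P).
    by rewrite /u polyCN opprK -subr_sqr polyC1 expr1n.
  have r1 : root (u ^+ n)^`(j) 1 by rewrite uE exprMn root_derivn_exp.
  have rN1 : root (u ^+ n)^`(j) (-1) by rewrite uE mulrC exprMn root_derivn_exp.
  have [||t [st sot rt bt]] := @sorted_roots_deriv R (u ^+ n)^`(j) (-1) (rcons s 1).
  - rewrite rcons_path path_min_sorted ?sos /=; last first.
      by apply/allP => z /(allP bs) /andP[].
    case: (lastP s) bs => [_|s' z]; rewrite ?last_rcons ?all_rcons /=; first by lra.
    by case/andP => /andP[].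
  - by rewrite /= all_rcons rN1 r1 rs.
  exists t; split; rewrite ?st ?size_rcons ?ss // ?derivnS //.
  by move: bt; rewrite last_rcons.
have [s [ss sos rs bs]] := iter_rolle n (leqnn n).
have n0 : P n != 0 by rewrite -size_poly_eq0 size_legendre.
have rE : root (u ^+ n)^`(n) =1 root (P n).
  by move=> z; rewrite rodrigues rootZ // mulf_neq0 ?expf_neq0 // pnatr_eq0 -lt0n fact_gt0.
rewrite (eq_all rE) in rs.
exists s; split=> // z; apply/idP/idP => [rz|/(allP rs)//].
apply: contraT => /= zs.
(* A root outside [s] would give n+1 distinct roots to a polynomial of degree n. *)
have := @max_poly_roots R (P n) (z :: s) n0; rewrite /= rz rs zs size_legendre ss.
by rewrite (sorted_uniq lt_trans ltxx sos) ltnn => /(_ isT isT).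
Qed.

Lemma legendre_root_itv n (t : R) : root (P n) t -> -1 < t < 1.
Proof. by have [s [_ _ /allP bs ->]] := legendre_roots n; exact: bs. Qed.

Lemma legendre_nonneg_roots n : exists x : 'I_((n + 1) %/ 2) -> R,
  (forall i j : 'I_((n + 1) %/ 2), (i < j)%N -> x j < x i) /\
  (forall t, (exists i, t = x i) <-> 0 <= t <= 1 /\ root (P n) t).
Proof.
have [s [ss sos bs rs]] := legendre_roots n.
(* By parity the root set is symmetric, and a strictly sorted list is determined by its elements. *)
have rev_s : s = rev [seq - z | z <- s].
  apply: lt_sorted_eq => //.
    rewrite rev_sorted sorted_map; apply: sub_sorted sos => a b /=.
    by rewrite ltrN2.
  move=> z; rewrite mem_rev -[z in RHS]opprK (mem_map oppr_inj).
  by rewrite -[LHS]rs -[RHS]rs !rootE legendre_parity mulf_eq0 signr_eq0.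
have nthN i : (i < n)%N -> s`_(n - i.+1) = - s`_i.
  move=> ni; rewrite [in LHS]rev_s nth_rev ?size_map ss; last by lia.
  have -> : (n - (n - i.+1).+1 = i)%N by lia.
  by rewrite (nth_map 0) // ss.
have s_mono i j : (i < j)%N -> (j < n)%N -> s`_i < s`_j.
  by move=> ij jn; apply: (sorted_ltn_nth lt_trans 0 sos); rewrite ?inE ?ss //; lia.
(* The i-th largest root, counting from 0. *)
exists (fun i => s`_(n - i.+1)); split=> [i j ij|t].
  by apply: s_mono; have := ltn_ord j; lia.
split=> [[i ->]|[/andP[t0 t1]]].
  have [mem_i lt_i] : s`_(n - i.+1) \in s /\ (i < n)%N.
    by rewrite mem_nth ?ss; have := ltn_ord i; lia.
  split; last by rewrite rs.
  have /andP[_ /ltW ->] := allP bs _ mem_i; rewrite andbT.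
  have : s`_i <= s`_(n - i.+1).
    have : (i <= n - i.+1)%N by have := ltn_ord i; lia.
    rewrite leq_eqVlt => /predU1P[<- //|h]; apply/ltW/s_mono => //; lia.
  by rewrite nthN //; lra.
rewrite rs => /(nthP 0) [k]; rewrite ss => kn tk.
(* Otherwise the mirror image -t of the root t would have a larger index than t, giving t < -t
   against 0 <= t. *)
have kn' : (n - k.+1 < (n + 1) %/ 2)%N.
  rewrite ltnNge; apply/negP => h.
  have : s`_k < s`_(n - k.+1) by apply: s_mono; lia.
  by rewrite nthN // tk; lra.
exists (Ordinal kn') => /=; rewrite -tk; congr (s`_ _); lia.
Qed.

End LegendreRoots.

(** * Sonin's function *)

(** The derivative may vanish inside the interval, but a nonzero polynomial has isolated zeros: the
    decrease is strict up to the first zero of the derivative after [x], and weak from there on. *)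
Lemma horner_decr (R : rcfType) (p : {poly R}) (a b : R) :
  p^`() != 0 -> (forall x, x \in `]a, b[ -> p^`().[x] <= 0) ->
  {in `[a, b] &, forall x y, x < y -> p.[y] < p.[x]}.
Proof.
move=> p0 dp x y xab yab xy.
have sub z : z \in `]x, y[ -> p^`().[z] <= 0.
  move=> zxy; apply: dp; apply: subitvP zxy.
  by rewrite /(_ <= _)%O/= !bnd_simp ?(itvP xab) ?(itvP yab).
have zx := next_root_gt xy p0; have zy := next_root_in p^`() x y.
(* [next_root] returns [y] when the derivative has no zero in []x, y[]. *)
rewrite (max_l (ltW xy)) in zy; set z := next_root _ _ _ in zx zy.
have le_zy : z <= y by rewrite (itvP zy).
have le_pzy : p.[y] <= p.[z].
  rewrite -lerN2 -!hornerN; apply: (@ler_hornerW _ x y) => //.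
    by move=> w /sub; rewrite derivN hornerN oppr_ge0.
  by rewrite in_itv /= (ltW xy) lexx.
apply: (le_lt_trans le_pzy); apply: (@gtr_hornerW _ p x z) => //.
- move=> w wxz; rewrite lt_neqAle sub ?andbT; last first.
    by apply: subitvPr wxz; rewrite bnd_simp.
  by rewrite -rootE; apply: next_noroot wxz.
- by rewrite bound_in_itv /<=%O /= ltW.
- by rewrite bound_in_itv /<=%O /= ltW.
Qed.

Section Sonin.
Variable R : realType.
Local Notation P := (legendre R).
Local Notation phi := (phiLGL R).

Lemma phiLGL_ode n :
  (1 - 'X^2) * (phi n)^`()^`() = - (n * n.+1)%:R *: phi n.
Proof.
rewrite phiLGL_deriv derivZ -scalerAr scaleNr phiLGL_eq scaleNr.
by rewrite opprK.
Qed.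

Definition sonin n : {poly R} :=
  phi n ^+ 2 + ((n * n.+1)%:R)^-1 *: ((1 - 'X^2) * (phi n)^`() ^+ 2).

Lemma deriv_sonin n : (0 < n)%N ->
  (sonin n)^`() = - (2 / (n * n.+1)%:R) *: ('X * (phi n)^`() ^+ 2).
Proof.
move=> n0; have N0 : (n * n.+1)%:R != 0 :> R by rewrite pnatr_eq0 muln_eq0; lia.
apply: (scalerI N0).
rewrite /sonin derivD derivZ scalerDr. rewrite [X in _ + X]scalerA divff // scale1r.
rewrite [RHS]scalerA mulrN [_%:R * (_ / _)]mulrCA divff // mulr1.
have := phiLGL_ode n; move: (phi n) => f e.
have -> : (f ^+ 2)^`() = 2%:R * f * f^`() by rewrite deriv_exp /= expr1 -mulr_natr; ring.
(* The second derivative is grouped with [1 - 'X^2] so that the differential equation replaces it,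
   and the cross terms in f f' cancel. *)
have -> : ((1 - 'X^2) * f^`() ^+ 2)^`() =
          - 2%:R * 'X * f^`() ^+ 2 + 2%:R * f^`() * ((1 - 'X^2) * f^`()^`()).
  rewrite derivM derivB -polyC1 derivC derivXn deriv_exp /= polyC1.
  by rewrite expr1; ring.
by rewrite e -!mul_polyC !polyCN !polyC_natr; ring.
Qed.

Lemma sonin_decr n (x y : R) : (0 < n)%N -> 0 <= x -> x < y -> y <= 1 ->
  (sonin n).[y] < (sonin n).[x].
Proof.
move=> n0 x0 xy y1; have N0 : 0 < (n * n.+1)%:R :> R by rewrite ltr0n muln_gt0 n0.
apply: (@horner_decr _ _ 0 1) => //; rewrite ?in_itv /=; [| |lra|lra].
  have c0 : 2 * n%:R + 1 != 0 :> R by rewrite gt_eqF // ltr_wpDl // mulr_ge0.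
  have d0 : (phi n)^`() != 0.
    by rewrite phiLGL_deriv scaler_eq0 negb_or c0 -size_poly_eq0 size_legendre.
  rewrite deriv_sonin // scaler_eq0 negb_or oppr_eq0 mulf_neq0 ?invr_eq0 ?gt_eqF //=.
  by rewrite mulf_neq0 ?polyX_eq0 ?expf_neq0.
move=> z; rewrite in_itv /= => /andP[z0 _].
rewrite deriv_sonin // hornerZ hornerM hornerX horner_exp mulNr oppr_le0.
by apply: mulr_ge0; [exact: divr_ge0|apply: mulr_ge0; [exact: ltW|exact: sqr_ge0]].
Qed.

Lemma sonin_horner n (x : R) : (sonin n).[x] = (phi n).[x] ^+ 2 +
  (1 - x ^+ 2) * ((2 * n%:R + 1) * (P n).[x]) ^+ 2 / (n * n.+1)%:R.
Proof.
rewrite /sonin phiLGL_deriv hornerD horner_exp hornerZ hornerM horner_exp hornerZ.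
have -> : (1 - 'X^2 : {poly R}).[x] = 1 - x ^+ 2 by rewrite !hornerE.
by rewrite [in RHS]mulrC.
Qed.

Lemma phiLGL_le_sonin n (x : R) : `|x| <= 1 -> (phi n).[x] ^+ 2 <= (sonin n).[x].
Proof.
move=> x1; rewrite sonin_horner lerDl; apply: divr_ge0 => //.
apply: mulr_ge0; last exact: sqr_ge0.
by rewrite subr_ge0 -real_normK ?num_real // expr_le1.
Qed.

(** A common zero would make Sonin's function vanish at [x], although it decreases strictly from
    there to a nonnegative value at 1. *)
Lemma phiLGL_root_neq0 n (x : R) : (0 < n)%N -> 0 <= x -> root (P n) x ->
  (phi n).[x] != 0.
Proof.
move=> n0 x0 rx; have /andP[_ x1] := legendre_root_itv rx; apply/eqP => px.
have := sonin_decr n0 x0 x1 (lexx 1).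
have := @phiLGL_le_sonin n 1; rewrite normr1 lexx => /(_ isT).
rewrite [(sonin n).[x]]sonin_horner px (rootP rx) mulr0 expr0n mulr0 mul0r addr0.
by move=> /(le_trans (sqr_ge0 _)) /le_lt_trans h /h; rewrite ltxx.
Qed.

Lemma phiLGL_root_incr n (x y : R) : (0 < n)%N ->
  0 <= x -> x < y -> root (P n) x -> root (P n) y ->
  `|(phi n).[y]| < `|(phi n).[x]|.
Proof.
move=> n0 x0 xy rx ry; have /andP[_ /ltW y1] := legendre_root_itv ry.
have := sonin_decr n0 x0 xy y1; rewrite !sonin_horner (rootP rx) (rootP ry).
rewrite !mulr0 expr0n /= !mulr0 !mul0r !addr0.
by rewrite -[X in X < _]real_normK ?num_real // -[X in _ < X]real_normK ?num_real // ltr_pXn2r.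
Qed.

End Sonin.

(** * Wallis integrals and central values *)

(** Passage to the limit in archimedean form, used both for the sharp central bound and for the
    optimality of the constant. *)
Lemma le_of_le_add_inv (R : archiRealFieldType) (x y C : R) :
  (forall k : nat, x <= y + C / k.+1%:R) -> x <= y.
Proof.
move=> h; rewrite leNgt; apply/negP => yx.
have := archi_boundP (normr_ge0 (C / (x - y))); set k := Num.bound _ => hk.
have := h k; rewrite -lerBlDl ler_pdivlMr ?ltr0n //.
rewrite normrM normfV (gtr0_norm (_ : 0 < x - y)) ?subr_gt0 // ltr_pdivrMr ?subr_gt0 // in hk.
have := ler_norm C; rewrite -natr1; nra.
Qed.

Lemma natr_doubleS (R : pzRingType) m : m.*2.+1%:R = 2 * m%:R + 1 :> R.
Proof. by rewrite -natr1 -muln2 natrM mulr_natr -mulr_natl. Qed.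

Lemma natr_doubleSS (R : pzRingType) m : m.*2.+2%:R = 2 * m%:R + 2 :> R.
Proof. by rewrite -natr1 natr_doubleS -addrA. Qed.

Section Wallis.
Variable R : realType.

(* The primitive of sin ^+ n vanishing at 0, by the reduction formula. *)
Fixpoint sin_exp_prim (n : nat) : R -> R :=
  match n with
  | 0 => id
  | 1 => cst 1 - cos
  | k.+2 => k.+2%:R^-1 \*: (k.+1%:R \*: sin_exp_prim k - (@sin R ^+ k.+1) * cos)
  end.

Lemma is_derive_sin_exp_prim n (x : R) :
  is_derive x 1 (sin_exp_prim n) (sin x ^+ n).
Proof.
(* The recursion goes back two steps, so two consecutive exponents are treated together. *)
suff : is_derive x 1 (sin_exp_prim n) (sin x ^+ n) /\
       is_derive x 1 (sin_exp_prim n.+1) (sin x ^+ n.+1) by case.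
elim: n => [|n [IH0 IH1]]; split => //.
- by rewrite expr0; exact: is_derive_id.
- by apply: is_derive_eq; rewrite sub0r opprK expr1.
rewrite [sin_exp_prim n.+2]/=; apply: is_derive_eq.
rewrite /= /GRing.scale /= !exprfctE.
have n2 : n.+2%:R != 0 :> R by rewrite pnatr_eq0.
apply: (mulfI n2); rewrite [LHS]mulrA mulfV // mul1r.
have : cos x * cos x = 1 - sin x ^+ 2 by rewrite -expr2 cos2sin2.
set s := sin x; set c := cos x => ec.
transitivity (n.+1%:R * s ^+ n - (n.+1%:R * s ^+ n * (c * c) - s ^+ n.+2)).
  by rewrite !exprS; ring.
by rewrite ec !exprS -[n.+2%:R]natr1; ring.
Qed.

(** The integral of sin^n over [0, pi/2], taken as a value of the primitive so that only derivatives
    are needed. *)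
Definition wallis n : R := sin_exp_prim n (pi / 2).

Lemma wallis0 : wallis 0 = pi / 2. Proof. by []. Qed.

Lemma wallis1 : wallis 1 = 1.
Proof. by rewrite /wallis /= !fctE cos_pihalf subr0. Qed.

Lemma wallisSS n : n.+2%:R * wallis n.+2 = n.+1%:R * wallis n.
Proof.
rewrite /wallis /= !fctE cos_pihalf mulr0 subr0 /GRing.scale /=.
by rewrite mulrA mulfV ?pnatr_eq0 // mul1r.
Qed.

Lemma wallis_gt0 n : 0 < wallis n.
Proof.
suff : 0 < wallis n /\ 0 < wallis n.+1 by case.
elim: n => [|n [w0 w1]].
  by rewrite wallis0 wallis1 ltr01 divr_gt0 ?pi_gt0.
split=> //; rewrite -(@pmulr_rgt0 _ n.+2%:R) ?ltr0n // wallisSS.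
by rewrite mulr_gt0 ?ltr0n.
Qed.

(** The mean value theorem for the difference of the primitives, whose derivative sin^n (1 - sin) is
    nonnegative on [0, pi/2]. *)
Lemma wallis_noninc n : wallis n.+1 <= wallis n.
Proof.
have prim0 k : sin_exp_prim k 0 = 0.
  suff : sin_exp_prim k 0 = 0 /\ sin_exp_prim k.+1 0 = 0 by case.
  elim: k => [|k [e0 e1]]; first by rewrite /= !fctE cos0 subrr.
  split=> //; rewrite [sin_exp_prim k.+2]/= !fctE.
  by rewrite /= e0 sin0 expr0n mul0r /GRing.scale /= !mulr0 subrr mulr0.
have pi2 : 0 < pi / 2 :> R by rewrite divr_gt0 ?pi_gt0.
have d (x : R) : is_derive x 1 (sin_exp_prim n - sin_exp_prim n.+1)
    (sin x ^+ n - sin x ^+ n.+1).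
  have := is_derive_sin_exp_prim n x; have := is_derive_sin_exp_prim n.+1 x.
  by move=> ? ?; exact: is_deriveB.
have [|c cI] := @MVT R (sin_exp_prim n - sin_exp_prim n.+1) _ 0 (pi / 2) pi2 (fun x _ => d x).
  by apply: derivable_within_continuous => x _; apply: (@ex_derive _ _ _ _ _ _ _ (d x)).
rewrite !fctE !prim0 !subr0 => h.
rewrite /wallis -subr_ge0 h mulr_ge0 ?(ltW pi2) //.
have s0 : 0 <= sin c.
  by apply: sin_ge0_pi; move: cI; rewrite !in_itv /=; have := pi_gt0 R; lra.
rewrite exprS -{1}[sin c ^+ n]mul1r -mulrBl mulr_ge0 ?exprn_ge0 //.

Qed.

(** The reduction formula makes the left-hand side independent of [n]. *)
Lemma wallis_prod n : n.+1%:R * (wallis n * wallis n.+1) = pi / 2.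
Proof.
elim: n => [|n <-]; first by rewrite wallis0 wallis1 mulr1 mul1r.
by rewrite mulrCA wallisSS mulrCA [wallis n * _]mulrC.
Qed.

Local Notation P := (legendre R).

Lemma legendre_center_sq m :
  (2 * m%:R + 2) ^+ 2 * (P m.+1.*2).[0] ^+ 2 = (2 * m%:R + 1) ^+ 2 * (P m.*2).[0] ^+ 2.
Proof.
rewrite -!exprMn doubleS; have := legendre_center R m.*2.
by rewrite natr_doubleS natr_doubleSS => ->; rewrite mulNr sqrrN.
Qed.

(** Both sides are multiplied by ((2m+1)/(2m+2))^2 when m grows by one, and they agree at m = 0. *)
Lemma wallis_legendre m : wallis m.*2 ^+ 2 = (P m.*2).[0] ^+ 2 * (pi / 2) ^+ 2.
Proof.
elim: m => [|m IH]; first by rewrite wallis0 legendre0 hornerC expr1n mul1r.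
have c0 : (2 * m%:R + 2) ^+ 2 != 0 :> R by rewrite expf_neq0 // gt_eqF // ltr_wpDl // mulr_ge0.
apply: (mulfI c0); rewrite [RHS]mulrA legendre_center_sq -[RHS]mulrA -IH doubleS -!exprMn.
congr (_ ^+ 2); have := wallisSS m.*2.
by rewrite natr_doubleS natr_doubleSS.
Qed.

Lemma legendre_center_lower m : 2 <= pi * (2 * m%:R + 1) * (P m.*2).[0] ^+ 2.
Proof.
have p0 := pi_gt0 R.
have := wallis_prod m.*2; have := wallis_legendre m.
have := wallis_noninc m.*2; have := wallis_gt0 m.*2.
rewrite natr_doubleS; have m0 : 0 <= m%:R :> R by [].
move=> w0 w1 e1 e2.
(* Monotonicity replaces the odd factor in [wallis_prod] by the even one. *)
have : pi / 2 <= (2 * m%:R + 1) * wallis m.*2 ^+ 2.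
  by rewrite -e2 ler_wpM2l ?addr_ge0 ?mulr_ge0 // expr2 ler_wpM2l ?(ltW w0).
rewrite e1; set q := _ ^+ 2; nra.
Qed.

(** Here [wallis_prod] is used at the preceding odd index. The bound has the right leading constant
    and serves to identify the limit in [legendre_center_upper]. *)
Lemma legendre_center_upper0 m : pi * m%:R * (P m.*2).[0] ^+ 2 <= 1.
Proof.
case: m => [|m]; first by rewrite mulr0 mul0r.
have p0 := pi_gt0 R.
have := wallis_prod m.*2.+1; have := wallis_legendre m.+1; rewrite doubleS.
have := wallis_noninc m.*2.+1; have := wallis_gt0 m.*2.+2.
have -> : m.*2.+2%:R = 2 * m.+1%:R :> R by rewrite -doubleS -muln2 natrM mulrC.
move=> w0 w1 e1 e2.
have : 2 * m.+1%:R * wallis m.*2.+2 ^+ 2 <= pi / 2.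
  by rewrite -e2 ler_wpM2l ?mulr_ge0 // expr2 ler_wpM2r // ltW.
rewrite e1; set q := _ ^+ 2; nra.
Qed.

Lemma legendre_center_upper m : pi * (4 * m%:R + 1) * (P m.*2).[0] ^+ 2 <= 4.
Proof.
pose s k : R := (4 * k%:R + 1) * (P k.*2).[0] ^+ 2.
have p0 := pi_gt0 R.
have s_nondec k : s k <= s k.+1.
  have e := legendre_center_sq k; have k0 : 0 <= k%:R :> R by [].
  have c0 : 0 < (2 * k%:R + 2) ^+ 2 :> R by rewrite exprn_gt0 // ltr_wpDl // mulr_ge0.
  rewrite -(ler_pM2l c0) /s [X in _ <= X]mulrCA e.
  have := sqr_ge0 (P k.*2).[0]; set q := _ ^+ 2; rewrite -natr1 => q0.
  (* The difference is exactly q because (2k+1)^2 (4k+5) - (2k+2)^2 (4k+1) = 1. *)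
  by rewrite -subr_ge0 (_ : _ - _ = q) //; ring.
have s_mono k : s m <= s (m + k)%N.
  by elim: k => [|k IH]; rewrite ?addn0 // addnS (le_trans IH).
(* Far out in the sequence, with b = k+1, [legendre_center_upper0] bounds pi times [s] by 4 plus a
   remainder pi q <= 1/b. *)
rewrite -mulrA -/(s m); apply: (@le_of_le_add_inv _ _ _ 1) => k.
apply: (@le_trans _ _ (pi * s (m + k.+1)%N)); first by rewrite ler_pM2l.
have := legendre_center_upper0 (m + k.+1); rewrite /s natrD.
have m0 : 0 <= m%:R :> R by []; have k0 : 0 < k.+1%:R :> R by rewrite ltr0n.
move: (m%:R) (k.+1%:R) (_ ^+ 2) (sqr_ge0 (P (m + k.+1).*2).[0]) m0 k0 => a b q q0 a0 b0 h.
rewrite div1r -(ler_pM2r b0) [X in _ <= X]mulrDl mulVf ?gt_eqF //.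
have : pi * b * q <= 1.
  apply: le_trans h; rewrite -!mulrA ler_pM2l // mulrDl lerDr mulr_ge0 //.
nra.
Qed.

End Wallis.

(** * Local maxima and uniform bounds for [phi] *)

(** Algebraic second-derivative test: p - p(z) = q (X - z)^2 with 2 q(z) = p''(z), and q stays
    negative near z by continuity. *)
Lemma poly_local_max (R : realType) (p : {poly R}) (z : R) :
  p^`().[z] = 0 -> p^`()^`().[z] < 0 -> \forall y \near z, p.[y] <= p.[z].
Proof.
move=> d1 d2.
have /factor_theorem[q1 e1] : root (p - p.[z]%:P) z by rewrite rootE !hornerE subrr.
have dp : p^`() = q1^`() * ('X - z%:P) + q1.
  by have := congr1 (@deriv R) e1; rewrite derivB derivC subr0 derivM derivXsubC mulr1.
have /factor_theorem[q e2] : root q1 z.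
  by rewrite rootE -d1 dp hornerD hornerM hornerXsubC subrr mulr0 add0r.
have qz : q.[z] < 0.
  have : p^`()^`().[z] = q.[z] *+ 2.
    rewrite dp e2 !(derivXsubC, mulr1, derivD, derivM).
    by rewrite !(hornerXsubC, hornerD, hornerM, subrr, mulr0, add0r) mulr2n.
  by move=> e; move: d2; rewrite e pmulrn_llt0.
have : \forall y \near z, q.[y] < 0.
  by have /cvgr_lt := @continuous_horner R q z; apply.
apply: filterS => y qy; rewrite -subr_le0.
have -> : p.[y] - p.[z] = q.[y] * (y - z) ^+ 2.
  have := congr1 (fun f => f.[y]) e1; rewrite hornerD hornerN hornerC => ->.
  by rewrite e2 !hornerM !hornerXsubC expr2 mulrA.
by rewrite mulr_le0_ge0 ?sqr_ge0 // ltW.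
Qed.

Section PhiLGL.
Variable R : realType.
Local Notation P := (legendre R).
Local Notation phi := (phiLGL R).

Lemma phiLGL_parity n (x : R) : (phi n).[- x] = (-1) ^+ n.+1 * (phi n).[x].
Proof.
case: n => [|n]; rewrite /phiLGL; first by rewrite legendre_parity.
by rewrite !hornerD !hornerN !legendre_parity !exprS !mulN1r opprK mulrBr.
Qed.

Lemma normr_phiLGLN n (x : R) : `|(phi n).[- x]| = `|(phi n).[x]|.
Proof. by rewrite phiLGL_parity normrM normrX normrN1 expr1n mul1r. Qed.

Lemma phiLGL_right n : (0 < n)%N -> (phi n).[1] = 0.
Proof. by case: n => // n _; rewrite /phiLGL hornerD hornerN !legendre1 subrr. Qed.

Lemma phiLGL_left n : (0 < n)%N -> (phi n).[-1] = 0.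
Proof. by move=> n0; rewrite phiLGL_parity phiLGL_right ?mulr0. Qed.

Lemma deriv_phiLGL_comb k : (0 < k)%N ->
  ((2 * k%:R + 3)^-1 *: phi k.+1 - (2 * k%:R - 1)^-1 *: phi k.-1)^`() = phi k.
Proof.
case: k => // k _; rewrite derivB 2!derivZ !phiLGL_deriv.
have n0 j : 2 * j%:R + 1 != 0 :> R by rewrite gt_eqF // ltr_wpDl // mulr_ge0.
have -> : 2 * k.+1%:R + 3 = 2 * k.+2%:R + 1 :> R by rewrite -[k.+2%:R]natr1; ring.
have -> : 2 * k.+1%:R - 1 = 2 * k%:R + 1 :> R by rewrite -natr1; ring.
by rewrite (scalerA _^-1) (scalerA (2 * k%:R + 1)^-1) !mulVf // !scale1r.
Qed.

Lemma odd_horner0 (p : {poly R}) : p.[- 0] = - p.[0] -> p.[0] = 0.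
Proof. by rewrite oppr0 => /eqP; rewrite -addr_eq0 -mulr2n mulrn_eq0 => /eqP. Qed.

Lemma legendre_center_odd n : odd n -> (P n).[0] = 0.
Proof. by move=> on; apply: odd_horner0; rewrite legendre_parity -signr_odd on expr1 mulN1r. Qed.

Lemma phiLGL_center_even n : ~~ odd n -> (phi n).[0] = 0.
Proof. by move=> en; apply: odd_horner0; rewrite phiLGL_parity -signr_odd /= en expr1 mulN1r. Qed.

Lemma phiLGL_center_odd m :
  (2 * m%:R + 2) * (phi m.*2.+1).[0] = - (4 * m%:R + 3) * (P m.*2).[0].
Proof.
have := legendre_center R m.*2; rewrite natr_doubleS natr_doubleSS.
by rewrite /= hornerD hornerN mulrBr => ->; ring.
Qed.

Lemma sonin_center_upper n : (0 < n)%N -> pi * n%:R * (sonin R n).[0] <= 8.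
Proof.
move=> n0; have p0 := pi_gt0 R; rewrite sonin_horner expr0n /= subr0 mul1r.
have m0 k : 0 <= k%:R :> R by [].
have [on|en] := boolP (odd n).
  have nE : n = n./2.*2.+1 by rewrite -[LHS]odd_double_half on.
  rewrite nE; move: (n./2) => m; rewrite legendre_center_odd /= ?odd_double //.
  rewrite -/(phi m.*2.+1) mulr0 expr0n mul0r addr0 natr_doubleS.
  have := congr1 (fun t => t ^+ 2) (phiLGL_center_odd m); rewrite /= !exprMn sqrrN.
  (* The value at 0 is expressed through [P m.+1.*2]: the central bound for [P m.*2] would give only
     9 instead of 8 when m = 0. *)
  have := legendre_center_upper R m.+1; have := legendre_center_sq R m.
  rewrite -[m.+1%:R]natr1; move: (m%:R) (m0 m) => a a0.
  set w := (_.[0]) ^+ 2; set q := (_.[0]) ^+ 2; set f := (_.[0]) ^+ 2 => ew lew ef.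
  have e : (2 * a + 1) ^+ 2 * f = (4 * a + 3) ^+ 2 * w.
    have c0 : (2 * a + 2) ^+ 2 != 0 by rewrite expf_neq0 // gt_eqF //; lra.
    by apply: (mulfI c0); rewrite mulrCA ef [RHS]mulrCA ew; ring.
  have c0 : 0 < (2 * a + 1) * (4 * a + 5) by nra.
  rewrite -(ler_pM2r c0).
  have -> : pi * (2 * a + 1) * f * ((2 * a + 1) * (4 * a + 5)) =
            pi * (4 * (a + 1) + 1) * ((2 * a + 1) ^+ 2 * f) by ring.
  rewrite e mulrCA -mulrA; have := ler_wpM2l (sqr_ge0 (4 * a + 3)) lew; nra.
have nE : n = n./2.*2 by rewrite -[LHS]odd_double_half (negPf en).
move: n0; rewrite {}nE double_gt0; move: (n./2) => m mgt0.
rewrite phiLGL_center_even ?odd_double // expr0n add0r.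
have := legendre_center_upper R m; rewrite natrM natr_doubleS -muln2 natrM.
have : 0 < m%:R :> R by rewrite ltr0n.
rewrite exprMn; move: (m%:R) => a a0; set q := (_.[0]) ^+ 2 => leq.
have c0 : 0 < 2 * a + 1 by lra.
rewrite -(ler_pM2r c0).
have -> : pi * (a * 2) * ((2 * (a * 2) + 1) ^+ 2 * q / (a * 2 * (2 * a + 1))) * (2 * a + 1)
   = (4 * a + 1) * (pi * (4 * a + 1) * q).
  by field; rewrite !gt_eqF.
nra.
Qed.

(** The squared form of the bound 4/sqrt(2 pi n). By symmetry x >= 0 may be assumed, where Sonin's
    function is at most its value at 0. *)
Lemma phiLGL_upper n (x : R) : (0 < n)%N -> -1 <= x <= 1 ->
  pi * n%:R * (phi n).[x] ^+ 2 <= 8.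
Proof.
move=> n0 x1; wlog x0 : x x1 / 0 <= x.
  move=> h; have [/h|x0] := lerP 0 x; first exact.
  have := h (- x); rewrite -[_ ^+ 2]real_normK ?num_real // normr_phiLGLN.
  rewrite real_normK ?num_real //.
  by apply; lra.
apply: le_trans (sonin_center_upper n0).
rewrite ler_pM2l ?mulr_gt0 ?pi_gt0 ?ltr0n //.
apply: (@le_trans _ _ (sonin R n).[x]).
  by apply: phiLGL_le_sonin; rewrite ger0_norm //; lra.
move: x0; rewrite le_eqVlt => /predU1P[<- //|x0].
by apply/ltW/sonin_decr => //; lra.
Qed.

Lemma phiLGL_lower m :
  8 <= pi * (m.*2.+1)%:R * (phi m.*2.+1).[0] ^+ 2 + 4 / m.+1%:R.
Proof.
have := congr1 (fun t => t ^+ 2) (phiLGL_center_odd m); rewrite !exprMn sqrrN.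
have := legendre_center_lower R m.
rewrite natr_doubleS -[m.+1%:R]natr1; have : 0 <= m%:R :> R by [].
move: (m%:R) => a a0; set q := (_.[0]) ^+ 2; set f := (_.[0]) ^+ 2 => leq ef.
have a1 : 0 < a + 1 by lra.
have c0 : 0 < (2 * a + 2) ^+ 2 by rewrite exprn_gt0 //; lra.
rewrite -(ler_pM2r c0).
have -> : (pi * (2 * a + 1) * f + 4 / (a + 1)) * (2 * a + 2) ^+ 2 =
    pi * (2 * a + 1) * ((2 * a + 2) ^+ 2 * f) + 16 * (a + 1).
  by field; rewrite gt_eqF.
(* The lower bound 2(4a+3)^2 misses 8(2a+2)^2 by 16a+14, which the error term 16(a+1) absorbs. *)
rewrite ef; have := ler_wpM2l (sqr_ge0 (4 * a + 3)) leq; nra.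
Qed.

Lemma normr_phiLGL_local_max n (t : R) : (0 < n)%N -> 0 <= t -> root (P n) t ->
  is_local_max_on `[0, 1] (fun y : R => `|(phi n).[y]|) t.
Proof.
move=> n0 t0 rt; have /andP[_ t1] := legendre_root_itv rt.
split; first by rewrite /= in_itv /= t0 ltW.
have pt := phiLGL_root_neq0 n0 t0 rt.
(* The square is a polynomial, unlike the absolute value; by the differential equation its second
   derivative at t is -2n(n+1) phi(t)^2 / (1 - t^2). *)
have : \forall y \near t, (phi n ^+ 2).[y] <= (phi n ^+ 2).[t].
  have d1 : (phi n)^`().[t] = 0 by rewrite phiLGL_deriv hornerZ (rootP rt) mulr0.
  have dd : (phi n ^+ 2)^`() = (phi n)^`() * phi n + phi n * (phi n)^`().
    by rewrite expr2 derivM.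
  apply: poly_local_max.
    by rewrite dd hornerD !hornerM d1 mul0r mulr0 addr0.
  rewrite dd derivD !derivM !(hornerD, hornerM) d1 !(mulr0, mul0r) addr0 add0r.
  have s1 : 0 < 1 - t ^+ 2 by nra.
  have := congr1 (fun f => f.[t]) (phiLGL_ode R n).
  rewrite hornerM hornerZ.
  have -> : (1 - 'X^2 : {poly R}).[t] = 1 - t ^+ 2 by rewrite !hornerE.
  have N0 : 0 < (n * n.+1)%:R :> R by rewrite ltr0n muln_gt0 n0.
  set d := _^`().[t]; move: pt; set f := _.[t] => f0 e.
  rewrite -(pmulr_rlt0 _ s1).
  have -> : (1 - t ^+ 2) * (d * f + f * d) = 2 * f * ((1 - t ^+ 2) * d) by ring.
  rewrite e; have : 0 < f ^+ 2 by rewrite exprn_even_gt0.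
  nra.
move=> h; apply: cvg_within; apply: filterS h => y; rewrite !horner_exp => h.
by rewrite -(@ler_pXn2r _ 2) // ?nnegrE // !real_normK ?num_real.
Qed.

Lemma local_max_root n (t : R) : (0 < n)%N ->
  is_local_max_on `[0, 1] (fun y : R => `|(phi n).[y]|) t ->
  0 <= t <= 1 /\ root (P n) t.
Proof.
move=> n0 [/=]; rewrite in_itv /= => t01 tmax; split => //.
have {tmax} [e e0 tmax] : exists2 e : R, 0 < e & forall y, 0 <= y <= 1 -> `|y - t| < e ->
    `|(phi n).[y]| <= `|(phi n).[t]|.
  move: tmax; rewrite near_withinE => /nbhs_ballP[e /= e0 h].
  exists e => // y y01 yt; apply: h; last by rewrite /= in_itv.
  by rewrite -ball_normE /= distrC.
pose a := Num.max 0 (t - e); pose b := Num.min 1 (t + e).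
have ab : a < b by rewrite gt_max !lt_min; lra.
have tmax_ab y : y \in `]a, b[ -> `|(phi n).[y]| <= `|(phi n).[t]|.
  rewrite in_itv /= gt_max lt_min => h; apply: tmax; first by lra.
  by rewrite ltr_norml; lra.
have c0 : 0 < 2 * n%:R + 1 :> R by rewrite ltr_wpDl // mulr_ge0.
have phi0 : phi n != 0.
  apply/eqP => h; have := congr1 (@deriv R) h; rewrite phiLGL_deriv deriv0 => /eqP.
  by rewrite scaler_eq0 gt_eqF // -size_poly_eq0 size_legendre.
(* If the maximal absolute value were 0, phi would vanish on all of []a, b[], but [neighpr_wit]
   supplies a point there that is not a root. *)
have pt0 : (phi n).[t] != 0.
  apply/eqP => pt; have [y yn] := neighpr_wit ab phi0.
  have yab : y \in `]a, b[.
    apply: subitvPr yn; rewrite bnd_simp.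
    by have := next_root_in (phi n) a b; rewrite (max_l (ltW ab)) => /itvP ->.
  have := tmax_ab y yab; rewrite pt normr0 normr_le0 -rootE => ry.
  by have := neighpr_root yn; rewrite ry.
(* Fermat's criterion needs an interior point, so 0 and 1 are settled first: for odd n, 0 is a zero
   of [P n]; for even n, phi vanishes at 0, and phi always vanishes at 1. *)
have [t0|t0] := eqVneq t 0.
  have [on|en] := boolP (odd n); first by rewrite t0 rootE legendre_center_odd.
  by move: pt0; rewrite t0 phiLGL_center_even ?eqxx.
have [t1|t1] := eqVneq t 1; first by move: pt0; rewrite t1 phiLGL_right ?eqxx.
have tab : t \in `]a, b[ by rewrite in_itv /= gt_max lt_min; lra.
have : is_derive t 1 (horner (phi n ^+ 2)) 0.
  apply: (derive1_at_max (ltW ab)) => // y yab.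
  rewrite !horner_exp -[_ ^+ 2]real_normK ?num_real // -[X in _ <= X]real_normK ?num_real //.
  by rewrite ler_pXn2r ?nnegrE // tmax_ab.
move=> /@derive_val; rewrite -derive1E -derivE expr2 derivM phiLGL_deriv.
rewrite hornerD !hornerM hornerZ => h.
have : (2 * (2 * n%:R + 1) * (phi n).[t]) * (P n).[t] = 0 by rewrite -h; ring.
by move/eqP; rewrite !mulf_eq0 (negPf pt0) orbF pnatr_eq0 (gt_eqF c0).
Qed.

End PhiLGL.

Theorem theorem2p1 (R : realType) :
  (* (i) *)
  ((forall (k : nat) (x : R),
      `|(phiLGL R k).[- x]| = `|(phiLGL R k).[x]|) /\
   (forall k : nat, (1 <= k)%N ->
      (phiLGL R k).[1] = 0 /\ (phiLGL R k).[- 1] = 0)) /\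
  (* (ii) *)
  (forall (k : nat) (x : R), (1 <= k)%N ->
     is_derive x 1
       (fun t : R => (phiLGL R k.+1).[t] / (2 * k%:R + 3)
                     - (phiLGL R k.-1).[t] / (2 * k%:R - 1))
       (phiLGL R k).[x]) /\
  (* (iii) *)
  (forall n : nat, (1 <= n)%N ->
     exists x : 'I_((n + 1) %/ 2) -> R,
       [/\ forall i j : 'I_((n + 1) %/ 2), (i < j)%N -> x j < x i,
           forall t : R,
             (exists i, t = x i) <-> 0 <= t <= 1 /\ root (legendre R n) t,
           forall t : R,
             (exists i, t = x i) <->
             is_local_max_on `[0, 1] (fun y : R => `|(phiLGL R n).[y]|) t
         & forall i j : 'I_((n + 1) %/ 2), (i < j)%N ->
             `|(phiLGL R n).[x i]| < `|(phiLGL R n).[x j]|]) /\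
  (* (iv) *)
  ((forall n : nat, (1 <= n)%N ->
      exists M : R,
        is_max_on `[- 1, 1] (fun y : R => `|(phiLGL R n).[y]|) M /\
        M <= 4 / Num.sqrt (2 * pi * n%:R)) /\
   (forall c : R, c < 4 / Num.sqrt (2 * pi) ->
      ~ (forall n : nat, (1 <= n)%N ->
           exists M : R,
             is_max_on `[- 1, 1] (fun y : R => `|(phiLGL R n).[y]|) M /\
             M <= c / Num.sqrt n%:R))).
Proof.
split; [split|split; [|split; [|split]]].
- exact: normr_phiLGLN.
- by move=> k k0; rewrite phiLGL_right ?phiLGL_left.
- move=> k x k0; rewrite -(deriv_phiLGL_comb R k0).
  rewrite (_ : (fun t : R => _) = horner ((2 * k%:R + 3)^-1 *: phiLGL R k.+1
             - (2 * k%:R - 1)^-1 *: phiLGL R k.-1)).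
    by rewrite derivE derive1E; apply: derivableP; exact: derivable_horner.
  move: (phiLGL _ _) (phiLGL _ _) => f g; apply/funext => t.
  by rewrite !(hornerD, hornerN, hornerZ) ![_^-1 * _]mulrC.
- move=> n n0; have [x [x_decr xP]] := legendre_nonneg_roots R n.
  exists x; split=> // [t|i j ij].
    split=> [/xP[/andP[t0 _] rt]|tmax]; first exact: normr_phiLGL_local_max.
    exact/xP/(local_max_root n0).
  have [|/andP[xj0 _] rj] := (xP (x j)).1; first by exists j.
  have [|_ ri] := (xP (x i)).1; first by exists i.
  by apply: phiLGL_root_incr => //; exact: x_decr.
- move=> n n0.
  have N11 : -1 <= 1 :> R by lra.
  have [|c c1 cmax] := @EVT_max R (fun y => `|(phiLGL R n).[y]|) (-1) 1 N11.
    apply: continuous_subspaceT => y; apply: continuous_comp; first exact: continuous_horner.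
    exact: norm_continuous.
  exists `|(phiLGL R n).[c]|; split.
    by split=> [|_ [y /= y1 <-]]; [exists c | exact: cmax].
  have n1 : 0 < n%:R :> R by rewrite ltr0n.
  have p0 := pi_gt0 R.
  have s0 : 0 < 2 * pi * n%:R :> R by rewrite !mulr_gt0.
  rewrite ler_pdivlMr ?sqrtr_gt0 // -(@ler_pXn2r _ 2) ?nnegrE ?mulr_ge0 ?sqrtr_ge0 //.
  rewrite exprMn real_normK ?num_real // sqr_sqrtr ?(ltW s0) //.
  have := @phiLGL_upper R n c n0; rewrite in_itv /= in c1; move=> /(_ c1).
  by move: (_ ^+ 2) => f; lra.
move=> c cpi h.
have p0 := pi_gt0 R.
(* The supposed constant is tested at x = 0 for the odd degrees 2m+1. *)
have c_lower m : 8 <= pi * c ^+ 2 + 4 / m.+1%:R.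
  apply: le_trans (phiLGL_lower R m) _; rewrite lerD2r -mulrA ler_pM2l //.
  have [M [[_ Mub] Mc]] := h m.*2.+1 isT.
  have N0 : 0 < m.*2.+1%:R :> R by rewrite ltr0n.
  have : `|(phiLGL R m.*2.+1).[0]| <= c / Num.sqrt m.*2.+1%:R.
    by apply: le_trans Mc; apply: Mub; exists 0 => //=; rewrite in_itv /=; lra.
  rewrite ler_pdivlMr ?sqrtr_gt0 // => le_c.
  rewrite -[X in X * _]sqr_sqrtr ?(ltW N0) // -exprMn mulrC -real_normK ?num_real //.
  have c0 : 0 <= c by apply: le_trans le_c; rewrite mulr_ge0 ?sqrtr_ge0.
  rewrite ler_pXn2r ?nnegrE // normrM (ger0_norm (sqrtr_ge0 _)) //.
(* A negative [c] is excluded by the case n = 1, so that the squares can be compared below. *)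
have c0 : 0 <= c.
  have [M [[_ Mub] Mc]] := h 1%N isT.
  have : 0 <= c / Num.sqrt 1%:R.
    apply: le_trans Mc; apply: le_trans (Mub `|(phiLGL R 1).[0]| _) => //.
    by exists 0 => //=; rewrite in_itv /=; lra.
  by rewrite sqrtr1 divr1.
have : 8 <= pi * c ^+ 2 by exact: le_of_le_add_inv c_lower.
apply/negP; rewrite -ltNge.
have s0 : 0 < 2 * pi :> R by rewrite mulr_gt0.
move: cpi; rewrite ltr_pdivlMr ?sqrtr_gt0 // -(@ltr_pXn2r _ 2) ?nnegrE ?mulr_ge0 ?sqrtr_ge0 //.
rewrite exprMn sqr_sqrtr ?(ltW s0) //; move: (_ ^+ 2) => f; lra.
Qed.
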